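(* Let $\mathcal{G}=(\mathcal{S},\mathbb{A})$ be a finite graded pointed DAG with layers $\mathcal{S}=\bigsqcup_{l=0}^{L}\mathcal{S}_l$, $\mathcal{S}_0=\{s_0\}$, $\mathcal{S}_L=\mathcal{X}$, let $R:\mathcal{X}\to(0,\infty)$ be a reward function, and let $0=m_0<m_1<\dots<m_K=L$ be indices of junction layers. Let $P_F$ be a forward policy with parameters $\theta$ and $P_B$ a backward policy with parameters $\phi$, with transition probabilities strictly positive on all edges and differentiable in their parameters ($P_F$ does not depend on $\phi$, $P_B$ does not depend on $\theta$). Let $F_k:\mathcal{S}_{m_k}\to(0,\infty)$, $k=0,\dots,K-1$, be any positive functions not depending on $\theta,\phi$, and set $F_K=R$. For $k\in\{0,\dots,K-1\}$ let $\hat p_k$ and $\check p_k$ be the probability distributions over the set $\mathcal{T}_k$ of partial trajectories from $\mathcal{S}_{m_k}$ to $\mathcal{S}_{m_{k+1}}$ given, for $\tau_k=(s_{m_k}\to\dots\to s_{m_{k+1}})\in\mathcal{T}_k$, by $$\hat p_k(\tau_k)\propto F_k(s_{m_k})P_F(\tau_k),\qquad \check p_k(\tau_k)\propto F_{k+1}(s_{m_{k+1}})P_B(\tau_k\mid s_{m_{k+1}}),$$ and let $$\mathcal{L}_{\rm SubTB}(\tau_k;P_F,P_B,F)=\left(\log\frac{F_k(s_{m_k})P_F(\tau_k)}{F_{k+1}(s_{m_{k+1}})P_B(\tau_k\mid s_{m_{k+1}})}\right)^2 .$$ Then, with $f_1:t\mapsto t\log t$ and $f_2:t\mapsto-\log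 t$, for every $k=0,\dots,K-1$, $$\mathbb{E}_{\tau_k\sim\check p_k}\left[\nabla_\phi\mathcal{L}_{\rm SubTB}(\tau_k;P_F,P_B,F)\right]=2\,\nabla_\phi D_{f_1}(\check p_k\|\hat p_k),$$ $$\mathbb{E}_{\tau_k\sim\hat p_k}\left[\nabla_\theta\mathcal{L}_{\rm SubTB}(\tau_k;P_F,P_B,F)\right]=2\,\nabla_\theta D_{f_2}(\check p_k\|\hat p_k),$$ where on the left-hand sides the gradient is taken of $\mathcal{L}_{\rm SubTB}(\tau_k)$ for fixed $\tau_k$ (not through the sampling distribution).
   Context: A pointed DAG is a finite directed acyclic graph $\mathcal{G}=(\mathcal{S},\mathbb{A})$ with exactly one state $s_0$ (the initial state) having no incoming edge. States with no outgoing edges are called terminating; $\mathcal{X}$ is the set of terminating states. It is graded if $\mathcal{S}=\bigsqcup_{l=0}^L\mathcal{S}_l$ with $\mathcal{S}_0=\{s_0\}$, $\mathcal{S}_L=\mathcal{X}$, and every edge goes from some layer $\mathcal{S}_i$ to $\mathcal{S}_{i+1}$. A forward policy $P_F(\cdot\mid s)$ is, for every non-terminating $s$, a probability distribution over the children of $s$ (states $s'$ with $s\to s'\in\mathbb{A}$). A backward policy $P_B(\cdot\mid s)$ is, for every $s\neq s_0$, a probability distribution over the parents of $s$ (states $s'$ with $s'\to s\in\mathbb{A}$). $\mathcal{T}_k$ is the set of directed paths $\tau_k=(s_{m_k}\to s_{m_k+1}\to\dots\to s_{m_{k+1}})$ in $\mathcal{G}$ starting at a state of $\mathcal{S}_{m_k}$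 and ending at a state of $\mathcal{S}_{m_{k+1}}$. For such a path, $P_F(\tau_k)=\prod_{(s\to s')\in\tau_k}P_F(s'\mid s)$ and $P_B(\tau_k\mid s_{m_{k+1}})=\prod_{(s\to s')\in\tau_k}P_B(s\mid s')$. The symbol $F$ stands for the collection $F_0,\dots,F_{K-1}$. For distributions $p,q$ on a finite set, with $q$ strictly positive, $D_f(p\|q)=\mathbb{E}_{\tau\sim q}\left[f\left(\frac{p(\tau)}{q(\tau)}\right)\right]$. Thus $D_{f_1}(p\|q)=D_{\rm KL}(p\|q)$ and $D_{f_2}(p\|q)=D_{\rm KL}(q\|p)$, with $D_{\rm KL}$ the Kullback–Leibler divergence. *)

(* Defs.v *)
From HB Require Import structures.
From mathcomp Require Import all_boot all_order all_algebra.
From mathcomp Require Import all_classical all_reals all_analysis.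

Set Implicit Arguments.
Unset Strict Implicit.
Unset Printing Implicit Defensive.

Import Order.TTheory GRing.Theory Num.Theory.
Import numFieldNormedType.Exports.

Local Open Scope ring_scope.

Definition terminating (S : finType) (e : rel S) (s : S) : bool :=
  [forall s', ~~ e s s'].

Record pointed_dag (S : finType) := PointedDag {
  edge : rel S;
  s0 : S;
  edge_acyclic : forall s s', edge s s' -> ~~ connect edge s' s;
  s0_unique_source : forall s, [forall s', ~~ edge s' s] = (s == s0)
}.

(* The layer S_l is [layer] = l: a function with values in {0, ..., L} is the
   same thing as a decomposition of S into L + 1 pairwise disjoint layers. *)
Record graded (S : finType) (G : pointed_dag S) (L : nat) (layer : S -> nat) :
    Prop := Graded {
  layer_le : forall s, (layer s <= L)%N;
  layer_first : forall s, (layer s == 0%N) = (s == s0 G);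
  layer_last : forall s, (layer s == L) = terminating (edge G) s;
  layer_edge : forall s s', edge G s s' -> layer s' = (layer s).+1
}.

(* [P s s'] is P_F(s' | s); its values off the edges are irrelevant. *)
Definition forward_policy (R : realType) (S : finType) (G : pointed_dag S)
    (P : S -> S -> R) : Prop :=
  forall s, ~~ terminating (edge G) s ->
    (forall s', edge G s s' -> 0 <= P s s') /\
    \sum_(s' | edge G s s') P s s' = 1.

(* [P s s'] is P_B(s' | s), for s' a parent of s. *)
Definition backward_policy (R : realType) (S : finType) (G : pointed_dag S)
    (P : S -> S -> R) : Prop :=
  forall s, s != s0 G ->
    (forall s', edge G s' s -> 0 <= P s s') /\
    \sum_(s' | edge G s' s) P s s' = 1.

(* Directed paths with n edges, listed by their n + 1 states, from layer a to
   layer b.  In a graded DAG every directed path from layer a to layer b has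
   exactly b - a edges (lemma [graded_path_size]), so that n = b - a gives all
   of them. *)
Definition paths (S : finType) (G : pointed_dag S) (layer : S -> nat)
    (a b n : nat) : {set n.+1.-tuple S} :=
  [set t : n.+1.-tuple S | [&& sorted (edge G) t,
     layer (tnth t ord0) == a & layer (tnth t ord_max) == b]].

Lemma graded_path_size (S : finType) (G : pointed_dag S) (L : nat)
    (layer : S -> nat) (x : S) (p : seq S) :
  graded G L layer -> path (edge G) x p ->
  size p = (layer (last x p) - layer x)%N.
Proof.
move=> gr; suff H : path (edge G) x p -> (layer (last x p) = layer x + size p)%N.
  by move=> /H ->; rewrite addKn.
elim: p x => [|y p IHp] x /=; first by rewrite addn0.
by case/andP=> /(layer_edge gr) lxy /IHp ->; rewrite lxy addSnnS.
Qed.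

Definition steps (S : Type) (t : seq S) : seq (S * S) := zip t (behead t).

Definition forward_prob (R : realType) (S : finType) (PF : S -> S -> R)
    (t : seq S) : R := \prod_(e <- steps t) PF e.1 e.2.

Definition backward_prob (R : realType) (S : finType) (PB : S -> S -> R)
    (t : seq S) : R := \prod_(e <- steps t) PB e.2 e.1.

Section SubTB.
Variables (R : realType) (S : finType) (G : pointed_dag S).
Variables (layer : S -> nat) (m : nat -> nat) (F : nat -> S -> R).
Variables (PF PB : S -> S -> R) (k : nat).

Definition subtraj := ((m k.+1 - m k).+1.-tuple S)%type.

Definition subtrajs : {set subtraj} :=
  paths G layer (m k) (m k.+1) (m k.+1 - m k).

Definition hat_weight (t : subtraj) : R :=
  F k (tnth t ord0) * forward_prob PF t.

Definition check_weight (t : subtraj) : R :=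
  F k.+1 (tnth t ord_max) * backward_prob PB t.

Definition hat_p (t : subtraj) : R :=
  hat_weight t / \sum_(u in subtrajs) hat_weight u.

Definition check_p (t : subtraj) : R :=
  check_weight t / \sum_(u in subtrajs) check_weight u.

Definition subTB (t : subtraj) : R :=
  ln (hat_weight t / check_weight t) ^+ 2.

End SubTB.

Arguments subtrajs {S} G layer m k.
Arguments hat_p {R S} G layer m F PF k t.
Arguments check_p {R S} G layer m F PB k t.
Arguments subTB {R S} m F PF PB k t.

Definition expect (R : realType) (V : lmodType R) (T : finType) (A : {set T})
    (q : T -> R) (g : T -> V) : V := \sum_(t in A) q t *: g t.

Definition fdiv (R : realType) (T : finType) (A : {set T}) (f : R -> R)
    (p q : T -> R) : R := expect A q (fun t => f (p t / q t) : R^o).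

Definition f1 (R : realType) (t : R) : R := t * ln t.

Definition f2 (R : realType) (t : R) : R := - ln t.

Definition grad (R : realType) (n : nat) (f : 'rV[R]_n -> R) (x : 'rV[R]_n) :
    'rV[R]_n := \row_i 'D_(delta_mx 0 i) f x.

(* Main.v *)
(* Summing out the path probabilities step by step, a policy contributes a
   factor 1 at each step, so the normalizers of hat p_k and check p_k are the
   sums of F_k over layer m_k and of F_{k+1} over layer m_{k+1}: they do not
   depend on the parameters.  Both divergences then have the form KL(w / Z || q)
   where w is the weight that depends on the differentiation variable and Z is
   constant, and with v the weight behind q both identities follow from
     grad KL = sum (ln (w / v) + const) grad w / Z,   sum grad w = grad Z = 0,
     (w / Z) grad (ln (w / v))^2 = 2 ln (w / v) grad w / Z. *)
Require Import Defs.
From HB Require Import structures.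
From mathcomp Require Import all_boot all_order all_algebra.
From mathcomp Require Import all_classical all_reals all_analysis.
From mathcomp Require Import ring.

Set Implicit Arguments.
Unset Strict Implicit.
Unset Printing Implicit Defensive.

Import Order.TTheory GRing.Theory Num.Theory.
Import numFieldNormedType.Exports.

Local Open Scope ring_scope.

(** * Path probabilities: reversal, positivity, differentiability *)

Lemma forward_prob_cons2 (R : realType) (S : finType) (P : S -> S -> R) x y s :
  forward_prob P [:: x, y & s] = P x y * forward_prob P (y :: s).
Proof. by rewrite /forward_prob /steps /= big_cons. Qed.

Lemma forward_prob1 (R : realType) (S : finType) (P : S -> S -> R) x :
  forward_prob P [:: x] = 1.
Proof. by rewrite /forward_prob /steps /= big_nil. Qed.

(** Reversing a path flips each of its edges, so a backward policy is a forward policy of the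
    reversed graph. One summation lemma then serves both normalizers. *)
Lemma backward_prob_rev (R : realType) (S : finType) (P : S -> S -> R) s :
  backward_prob P (rev s) = forward_prob P s.
Proof.
have rcons2 (t : seq S) (x y : S) :
    backward_prob P (rcons (rcons t y) x) = backward_prob P (rcons t y) * P x y.
  elim: t => [|z [|z' t] IHt].
  - by rewrite /backward_prob /steps /= big_seq1 big_nil mul1r.
  - by rewrite /backward_prob /steps /= !big_cons big_nil !mulr1.
  - move: IHt; rewrite /backward_prob /steps /= => IHt.
    by rewrite big_cons IHt [in RHS]big_cons mulrA.
elim: s => [|x [|y s] IHs].
- by rewrite /backward_prob /forward_prob /steps !big_nil.
- by rewrite /backward_prob /forward_prob /steps !big_nil.
- by rewrite !rev_cons rcons2 -rev_cons IHs forward_prob_cons2 mulrC.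
Qed.

Lemma forward_prob_gt0 (R : realType) (S : finType) (e : rel S)
    (P : S -> S -> R) (t : seq S) :
  (forall s s', e s s' -> 0 < P s s') -> sorted e t -> 0 < forward_prob P t.
Proof.
move=> P_gt0; elim: t => [|x [|y t] IHt]; rewrite ?forward_prob1 //.
  by rewrite /forward_prob /steps big_nil.
rewrite forward_prob_cons2 => /= /andP[exy pt].
by rewrite mulr_gt0 ?P_gt0 ?IHt.
Qed.

Lemma differentiable_forward_prob (R : realType) (S : finType) (e : rel S)
    (V : normedModType R) (P : V -> S -> S -> R) (x : V) (t : seq S) :
  (forall s s', e s s' -> differentiable (fun y => P y s s') x) ->
  sorted e t -> differentiable (fun y => forward_prob (P y) t) x.
Proof.
move=> dP; elim: t => [|a [|b t] IHt].
- move=> _; under eq_fun do rewrite /forward_prob /steps big_nil.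
  exact: differentiable_cst.
- move=> _; under eq_fun do rewrite forward_prob1.
  exact: differentiable_cst.
- move=> /= /andP[eab pt]; under eq_fun do rewrite forward_prob_cons2.
  by apply: differentiableM; [exact: dP | exact: IHt].
Qed.

(** * Summing out path probabilities *)

Lemma big_tuple_cons (V : nmodType) (T : finType) n (P : pred (seq T))
    (F : seq T -> V) :
  \sum_(t : n.+1.-tuple T | P t) F t =
  \sum_(x : T) \sum_(u : n.-tuple T | P (x :: u)) F (x :: u).
Proof.
rewrite pair_big_dep /=.
rewrite (reindex (fun p : T * n.-tuple T => [tuple of p.1 :: p.2])) //=.
exists (fun t : n.+1.-tuple T => (thead t, [tuple of behead t])).
  by move=> [x u] _; congr pair; exact: val_inj.
by move=> t _; rewrite [RHS]tuple_eta.
Qed.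

(* [Q n s] says that every path from [s] can be continued for [n] steps. *)
Lemma sum_forward_prob (R : realType) (S : finType) (e : rel S)
    (P : S -> S -> R) (Q : nat -> pred S) :
  (forall n s, Q n.+1 s -> \sum_(s' | e s s') P s s' = 1) ->
  (forall n s s', Q n.+1 s -> e s s' -> Q n s') ->
  forall n s, Q n s ->
    \sum_(u : n.-tuple S | path e s u) forward_prob P (s :: u) = 1.
Proof.
move=> P1 Qe; elim=> [|n IHn] s Qs.
  rewrite (big_pred1 [tuple]); first by rewrite forward_prob1.
  by move=> u; rewrite tuple0.
rewrite (big_tuple_cons _ (path e s) (fun u => forward_prob P (s :: u))) /=.
rewrite -[RHS](P1 n s Qs) [RHS]big_mkcond; apply: eq_bigr => s' _.
case: ifP => ess' /=; last by rewrite big_pred0.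
under eq_bigr do rewrite forward_prob_cons2.
by rewrite -big_distrr /= IHn ?mulr1 //; exact: Qe ess'.
Qed.

Lemma sum_weight_forward_prob (R : realType) (S : finType) (e : rel S)
    (P : S -> S -> R) (Q : nat -> pred S) (A : pred S) (F : S -> R) n :
  (forall n s, Q n.+1 s -> \sum_(s' | e s s') P s s' = 1) ->
  (forall n s s', Q n.+1 s -> e s s' -> Q n s') ->
  (forall s, A s -> Q n s) ->
  \sum_(t : n.+1.-tuple S | sorted e t && A (thead t))
     F (thead t) * forward_prob P t = \sum_(s | A s) F s.
Proof.
move=> P1 Qe AQ.
(* [big_tuple_cons] splits summands defined on sequences, hence these extensions; the values at the
   empty sequence are never reached. *)
pose B t := if t is x :: p then path e x p && A x else false.
pose G t := if t is x :: p then F x * forward_prob P t else 0.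
transitivity (\sum_(t : n.+1.-tuple S | B t) G t).
  by apply: eq_big => t; case/tupleP: t => x u; rewrite theadE.
rewrite (big_tuple_cons _ B G) [RHS]big_mkcond; apply: eq_bigr => s _ /=.
case: ifP => As; last by rewrite big_pred0 // => u; rewrite andbF.
under eq_bigl do rewrite andbT.
by rewrite -big_distrr /= (sum_forward_prob P1 Qe) ?mulr1 ?AQ.
Qed.

(** * Differential calculus and the gradient identity *)

Lemma is_diff_sum (R : numFieldType) (V W : normedModType R) (T : Type)
    (r : seq T) (P : pred T) (f df : T -> V -> W) (x : V) :
  (forall t, P t -> is_diff x (f t) (df t)) ->
  is_diff x (fun y => \sum_(t <- r | P t) f t y)
            (fun v => \sum_(t <- r | P t) df t v).
Proof.
move=> dfP; elim: r => [|t r IHr].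
  have nil0 U (g : T -> U -> W) : (fun y => \sum_(t <- [::] | P t) g t y) = 0.
    by apply: funext => y; rewrite big_nil.
  by rewrite !nil0; exact: is_diff_cst.
have consE U (g : T -> U -> W) : (fun y => \sum_(i <- t :: r | P i) g i y) =
    if P t then g t + (fun y => \sum_(i <- r | P i) g i y)
    else fun y => \sum_(i <- r | P i) g i y.
  by apply: funext => y; rewrite big_cons; case: ifP.
by rewrite !consE; case: ifPn => // Pt; apply: is_diffD; first exact: dfP.
Qed.

Lemma is_diff_ln (R : realType) (V : normedModType R) (f df : V -> R) (x : V) :
  0 < f x -> is_diff x f df -> is_diff x (fun y => ln (f y)) ((f x)^-1 *: df).
Proof.
move=> fx_gt0 f_diff; have [ln_der ln_val] := is_derive1_ln fx_gt0.
have ln_diff : is_diff (f x) (@ln R) ( *:%R^~ (f x)^-1).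
  apply: DiffDef; first exact/derivable1_diffP.
  by rewrite deriv1E // derive1E ln_val.
apply: (is_diff_eq (is_diff_comp f_diff ln_diff)).
by apply: funext => v /=; rewrite /= /GRing.scale /= mulrC.
Qed.

Lemma gradE (R : realType) n (f df : 'rV[R]_n -> R) x :
  is_diff x f df -> grad f x = \row_i df (delta_mx 0 i).
Proof.
by move=> f_diff; apply/rowP => i; rewrite !mxE deriveE // diff_val.
Qed.

Lemma sum_in_gt0 (R : numDomainType) (T : finType) (A : {set T}) (g : T -> R)
    (t : T) :
  t \in A -> (forall u, u \in A -> 0 < g u) -> 0 < \sum_(u in A) g u.
Proof.
move=> At g_gt0; rewrite (bigD1 t) //= ltr_wpDr ?g_gt0 //.
by apply: sumr_ge0 => u /andP[/g_gt0/ltW].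
Qed.

(** Common form of both identities: [w] carries the parameter being differentiated, [v] is frozen.
    Differentiability is part of the conclusion because ['D_] is a limit that takes a default value
    when it does not exist. *)
Lemma expect_grad_sqr_ln (R : realType) (T : finType) (A : {set T}) n
    (w : 'rV[R]_n -> T -> R) (v : T -> R) (x : 'rV[R]_n) :
  (forall y t, t \in A -> 0 < w y t) -> (forall t, t \in A -> 0 < v t) ->
  (forall t, t \in A -> differentiable (w^~ t) x) ->
  (forall y, \sum_(t in A) w y t = \sum_(t in A) w x t) ->
  let loss y t := ln (w y t / v t) ^+ 2 in
  let p y t := w y t / \sum_(u in A) w y u in
  let q t := v t / \sum_(u in A) v u in
  let KL y := \sum_(t in A) p y t * ln (p y t / q t) in
  [/\ forall t, t \in A -> differentiable (loss^~ t) x,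
      differentiable KL x &
      expect A (p x) (fun t => grad (loss^~ t) x) = 2 *: grad KL x].
Proof.
move=> w_gt0 v_gt0 w_diff; move ZE : (\sum_(t in A) w x t) => Z wZ loss p q KL.
set c := \sum_(u in A) v u in q KL *.
(* An element of [A] is required: over an empty [A] both normalizers are 0. *)
have Z_gt0 t : t \in A -> 0 < Z.
  by move=> At; rewrite -ZE (sum_in_gt0 At) // => u; exact: w_gt0.
have c_gt0 t : t \in A -> 0 < c by move=> At; exact: sum_in_gt0 At v_gt0.
pose dw t : 'rV[R]_n -> R := 'd (w^~ t) x.
have dwP t : t \in A -> is_diff x (w^~ t) (dw t).
  by move=> At; apply: DiffDef => //; exact: w_diff.
have lnwP t : t \in A ->
    is_diff x (fun y => ln (w y t)) ((w x t)^-1 *: dw t).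
  by move=> At; apply: is_diff_ln; [exact: w_gt0 | exact: dwP].
(* The total weight is constant in the parameter, so its differential vanishes. *)
have sum_dw h : \sum_(t in A) dw t h = 0.
  have dP := is_diff_sum (index_enum T) dwP; have := @diff_val _ _ _ _ _ _ _ dP.
  by under eq_fun do rewrite wZ; rewrite diff_cst => /(congr1 (@^~ h)).
have lossP t : t \in A -> is_diff x (loss^~ t)
    (fun h => 2 * (ln (w x t) - ln (v t)) * (dw t h / w x t)).
  move=> At.
  have -> : loss^~ t = ((fun y => ln (w y t)) - cst (ln (v t))) ^+ 2.
    by apply: funext => y; rewrite /loss ln_div // posrE ?w_gt0 ?v_gt0.
  have := is_diffX 1 (is_diffB (lnwP t At) (is_diff_cst (ln (v t)) x)).
  move/is_diff_eq; apply; apply: funext => h /=.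
  by rewrite !fctE /GRing.scale /= subr0 expr1 [_^-1 * _]mulrC.
(* The logarithms [ln c] and [ln Z] come from the normalizers, and the 1 from differentiating the
   logarithm in [w * ln w]. *)
have KLP : is_diff x KL (fun h => \sum_(t in A)
    (ln (w x t) - ln (v t) + (ln c - ln Z + 1)) * (dw t h / Z)).
  have -> : KL = fun y => \sum_(t in A)
      Z^-1 * (w y t * (ln (w y t) + (ln c - ln Z - ln (v t)))).
    apply: funext => y; apply: eq_bigr => t At; rewrite /p /q wZ.
    have [wt vt] := (w_gt0 y t At, v_gt0 t At).
    have [Zt ct] := (Z_gt0 t At, c_gt0 t At).
    by rewrite !ln_div ?posrE ?divr_gt0 //; ring.
  apply: is_diff_sum => t At.
  have := is_diffZ Z^-1 (is_diffM (dwP t At) (is_diffD (lnwP t At)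
    (is_diff_cst (ln c - ln Z - ln (v t)) x))).
  move/is_diff_eq; apply; apply: funext => h /=.
  rewrite !fctE /GRing.scale /= addr0 mulVKf ?gt_eqF ?w_gt0 //.
  by ring.
split; [by move=> t /lossP [] | by have [] := KLP |].
apply/rowP => i; rewrite (gradE KLP) /expect summxE !mxE.
under eq_bigr => t At do rewrite mxE (gradE (lossP t At)) mxE.
(* The bracket [ln c - ln Z + 1] is the same for all [t], so [sum_dw] kills its contribution. *)
under [in RHS]eq_bigr do rewrite mulrDl.
rewrite big_split /= -big_distrr -big_distrl /= sum_dw mul0r mulr0 addr0.
rewrite big_distrr; apply: eq_bigr => t At /=.
rewrite /p wZ; have := w_gt0 x t At; have := Z_gt0 t At.
by move=> /lt0r_neq0 Z0 /lt0r_neq0 w0; field; rewrite Z0 w0.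
Qed.

(** * Normalizers of the two trajectory distributions *)

Lemma layer_path_end (S : finType) (G : pointed_dag S) (L : nat)
    (layer : S -> nat) n (t : n.+1.-tuple S) :
  graded G L layer -> (0 < n)%N -> sorted (edge G) t ->
  layer (tnth t ord_max) = (layer (tnth t ord0) + n)%N.
Proof.
case/tupleP: t => x u gr n_gt0 /= /(graded_path_size gr) nE.
rewrite size_tuple in nE; rewrite -/(thead _) theadE.
have -> : tnth [tuple of x :: u] ord_max = last x u.
  by rewrite (tnth_nth x) /= (last_nth x) size_tuple.
(* Since [0 < n], the subtraction in [nE] is not truncated and can be undone. *)
by rewrite [in RHS]nE subnKC // ltnW // -subn_gt0 -nE.
Qed.

Lemma sum_hat_weight (R : realType) (S : finType) (G : pointed_dag S)
    (L : nat) (layer : S -> nat) (m : nat -> nat) (F : nat -> S -> R)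
    (P : S -> S -> R) (k : nat) :
  graded G L layer -> (m k < m k.+1)%N -> (m k.+1 <= L)%N ->
  forward_policy G P ->
  \sum_(t in subtrajs G layer m k) hat_weight F P t =
  \sum_(s | layer s == m k) F k s.
Proof.
move=> gr ltm leL polP.
(* With a step left, [s] lies below layer [L], so it is not terminating and its policy sums to 1. *)
pose Q n s := (layer s + n <= L)%N.
rewrite -[RHS](sum_weight_forward_prob (e := edge G) (P := P) (Q := Q)
  (F k) (n := (m k.+1 - m k)%N)).
(* The length of the path forces its end layer once its start layer is fixed. *)
- apply: eq_bigl => t; rewrite inE.
  case st : (sorted _ t) => //=.
  rewrite (layer_path_end gr) ?subn_gt0 //.
  by case: eqP => //= ->; rewrite subnKC ?eqxx // ltnW.
- move=> n s; rewrite /Q addnS => ltL; apply: (polP s _).2.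
  by rewrite -(layer_last gr) neq_ltn (leq_ltn_trans _ ltL) ?leq_addr.
- by move=> n s s' + /(layer_edge gr); rewrite /Q => + ->; rewrite addSnnS.
- by move=> s /eqP; rewrite /Q => ->; rewrite subnKC // ltnW.
Qed.

Lemma sum_check_weight (R : realType) (S : finType) (G : pointed_dag S)
    (L : nat) (layer : S -> nat) (m : nat -> nat) (F : nat -> S -> R)
    (P : S -> S -> R) (k : nat) :
  graded G L layer -> (m k < m k.+1)%N -> backward_policy G P ->
  \sum_(t in subtrajs G layer m k) check_weight F P t =
  \sum_(s | layer s == m k.+1) F k.+1 s.
Proof.
move=> gr ltm polP.
(* Walking backward, a step left means a positive layer, so [s] is not [s0 G]. *)
pose Q n s := (n <= layer s)%N.
rewrite -[RHS](sum_weight_forward_prob (e := fun s s' => edge G s' s) (P := P)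
  (Q := Q) (F k.+1) (n := (m k.+1 - m k)%N)).
(* Reversal is an involution on tuples; it makes the end state the head, where the weight [F k.+1]
   sits. *)
- rewrite (reindex (fun t : subtraj S m k => [tuple of rev t])) /=; last first.
    by exists (fun t : subtraj S m k => [tuple of rev t]) => t _;
      apply: val_inj; rewrite /= revK.
  have lastE (t : subtraj S m k) : tnth [tuple of rev t] ord_max = thead t.
    by rewrite (tnth_nth (thead t)) /= nth_rev size_tuple // subnn
      [RHS](tnth_nth (thead t)).
  apply: eq_big => t; last by rewrite /check_weight lastE backward_prob_rev.
  rewrite inE lastE /= rev_sorted.
  case st : (sorted _ t) => //=.
  have := layer_path_end gr (t := [tuple of rev t]).
  rewrite subn_gt0 ltm /= rev_sorted st lastE => /(_ isT isT) ->.
  apply/andP/eqP => [[_ /eqP]//|lE]; rewrite lE; split=> //.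
  by rewrite -(eqn_add2r (m k.+1 - m k)%N) lE subnKC // ltnW.
- move=> n s; rewrite /Q => lt0; apply: (polP s _).2.
  by rewrite -(layer_first gr) -lt0n (leq_trans _ lt0).
- by move=> n s s' + /(layer_edge gr); rewrite /Q => + lE; rewrite lE.
- by move=> s /eqP; rewrite /Q => ->; rewrite leq_subr.
Qed.

(** * The two gradient identities *)

Theorem proposition2 (R : realType) (S : finType) (G : pointed_dag S)
  (L : nat) (layer : S -> nat) (G_graded : graded G L layer)
  (Rew : S -> R) (Rew_gt0 : forall x, terminating (edge G) x -> 0 < Rew x)
  (K : nat) (m : nat -> nat) (m_first : m 0%N = 0%N) (m_last : m K = L)
  (m_incr : forall k, (k < K)%N -> (m k < m k.+1)%N)
  (p q : nat)
  (PF : 'rV[R]_p -> S -> S -> R) (PB : 'rV[R]_q -> S -> S -> R)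
  (PF_policy : forall theta, forward_policy G (PF theta))
  (PB_policy : forall phi, backward_policy G (PB phi))
  (PF_gt0 : forall theta s s', edge G s s' -> 0 < PF theta s s')
  (PB_gt0 : forall phi s s', edge G s s' -> 0 < PB phi s' s)
  (PF_diff : forall s s', edge G s s' ->
     forall theta, differentiable (fun theta' => PF theta' s s') theta)
  (PB_diff : forall s s', edge G s s' ->
     forall phi, differentiable (fun phi' => PB phi' s' s) phi)
  (F : nat -> S -> R)
  (F_gt0 : forall k s, (k < K)%N -> layer s = m k -> 0 < F k s)
  (F_last : forall x, terminating (edge G) x -> F K x = Rew x)
  (k : nat) (k_lt : (k < K)%N) (theta : 'rV[R]_p) (phi : 'rV[R]_q) :
  let T := subtrajs G layer m k in
  let hp := fun theta' => hat_p G layer m F (PF theta') k in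
  let cp := fun phi' => check_p G layer m F (PB phi') k in
  let loss := fun theta' phi' => subTB m F (PF theta') (PB phi') k in
  let D1 := fun phi' => fdiv T (@f1 R) (cp phi') (hp theta) in
  let D2 := fun theta' => fdiv T (@f2 R) (cp phi) (hp theta') in
  [/\ forall t, t \in T -> differentiable (fun phi' => loss theta phi' t) phi,
      differentiable D1 phi &
      expect T (cp phi) (fun t => grad (fun phi' => loss theta phi' t) phi)
        = 2 *: grad D1 phi] /\
  [/\ forall t, t \in T ->
        differentiable (fun theta' => loss theta' phi t) theta,
      differentiable D2 theta &
      expect T (hp theta) (fun t => grad (fun theta' => loss theta' phi t) theta)
        = 2 *: grad D2 theta].
Proof.
move=> T hp cp loss D1 D2.
have ltm := m_incr k k_lt.
(* Descending induction from [m K = L], on [K - j]. *)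
have m_leL j : (j <= K)%N -> (m j <= L)%N.
  move dE : (K - j)%N => d; elim: d j dE => [|d IHd] j dE leK.
    rewrite (_ : j = K) ?m_last //; apply/eqP.
    by rewrite eqn_leq leK -subn_eq0 dE.
  have ltK : (j < K)%N by rewrite -subn_gt0 dE.
  by rewrite (leq_trans (ltnW (m_incr j ltK))) ?IHd // subnS dE.
(* At the last junction, [k.+1 = K], positivity comes from the reward, as layer [L] consists of
   terminating states. *)
have F1_gt0 s : layer s = m k.+1 -> 0 < F k.+1 s.
  move=> ls; case: (ltnP k.+1 K) => [lt|le]; first exact: F_gt0.
  have kK : k.+1 = K by apply/eqP; rewrite eqn_leq k_lt.
  have s_end : terminating (edge G) s.
    by rewrite -(layer_last G_graded) ls kK m_last.
  by rewrite kK F_last ?Rew_gt0.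
have T_sorted t : t \in T -> sorted (edge G) t by rewrite inE => /and3P[].
have hw_gt0 th t : t \in T -> 0 < hat_weight F (PF th) t.
  move=> Tt; apply: mulr_gt0.
    by move: Tt; rewrite inE => /and3P[_ /eqP t0 _]; exact: F_gt0.
  exact: (forward_prob_gt0 (PF_gt0 th) (T_sorted t Tt)).
have cw_gt0 ph t : t \in T -> 0 < check_weight F (PB ph) t.
  move=> Tt; apply: mulr_gt0.
    by move: Tt; rewrite inE => /and3P[_ _ /eqP]; exact: F1_gt0.
  (* [backward_prob] is convertible to [forward_prob] of the policy with swapped arguments. *)
  exact: (forward_prob_gt0 (PB_gt0 ph) (T_sorted t Tt)).
have hw_diff t : t \in T ->
    differentiable (fun th => hat_weight F (PF th) t) theta.
  move=> Tt; apply: differentiableM; first exact: differentiable_cst.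
  apply: (differentiable_forward_prob _ (T_sorted t Tt)) => s s' ss'.
  exact: PF_diff.
have cw_diff t : t \in T ->
    differentiable (fun ph => check_weight F (PB ph) t) phi.
  move=> Tt; apply: differentiableM; first exact: differentiable_cst.
  apply: (differentiable_forward_prob (P := fun ph s s' => PB ph s' s) _
    (T_sorted t Tt)) => s s' ss'.
  exact: PB_diff.
have hw_sum th : \sum_(t in T) hat_weight F (PF th) t =
    \sum_(t in T) hat_weight F (PF theta) t.
  by rewrite !(sum_hat_weight (L := L)) ?m_leL.
have cw_sum ph : \sum_(t in T) check_weight F (PB ph) t =
    \sum_(t in T) check_weight F (PB phi) t.
  by rewrite !(sum_check_weight (L := L)).
have norm_gt0 (w : subtraj S m k -> R) t : t \in T ->
    (forall u, u \in T -> 0 < w u) -> 0 < w t / \sum_(u in T) w u.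
  by move=> Tt w_gt0; rewrite divr_gt0 ?w_gt0 // (sum_in_gt0 Tt).
have hp_gt0 th t : t \in T -> 0 < hp th t.
  by move=> Tt; exact: (norm_gt0 _ t Tt (hw_gt0 th)).
have cp_gt0 ph t : t \in T -> 0 < cp ph t.
  by move=> Tt; exact: (norm_gt0 _ t Tt (cw_gt0 ph)).
have D1E : D1 = fun ph => \sum_(t in T) cp ph t * ln (cp ph t / hp theta t).
  apply: funext => ph; apply: eq_bigr => t Tt.
  by rewrite /f1 /GRing.scale /= mulrA mulrCA divff ?mulr1 ?gt_eqF ?hp_gt0.
(* The sign in [f2] inverts the ratio, giving the divergence of [hp] from [cp]; the varying
   distribution again comes first. *)
have D2E : D2 = fun th => \sum_(t in T) hp th t * ln (hp th t / cp phi t).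
  apply: funext => th; apply: eq_bigr => t Tt.
  rewrite /f2 /GRing.scale /= -lnV; first by rewrite (invf_div (cp phi t)).
  by rewrite posrE divr_gt0 ?hp_gt0 ?cp_gt0.
(* The squared logarithm is unchanged when the ratio is inverted, so the check weight can play the
   role of [w]. *)
have lossE t : t \in T -> (fun ph => loss theta ph t) =
    fun ph => ln (check_weight F (PB ph) t / hat_weight F (PF theta) t) ^+ 2.
  move=> Tt; apply: funext => ph; rewrite /loss /subTB.
  by rewrite !ln_div ?posrE ?hw_gt0 ?cw_gt0 // -sqrrN opprB.
rewrite D1E D2E; split.
  have [lossP KLP gradP] :=
    expect_grad_sqr_ln cw_gt0 (hw_gt0 theta) cw_diff cw_sum.
  split=> [t Tt||]; [by rewrite lossE //; exact: lossP | exact: KLP |].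
  by rewrite -gradP; apply: eq_bigr => t Tt; rewrite lossE.
exact: (expect_grad_sqr_ln hw_gt0 (cw_gt0 phi) hw_diff hw_sum).
Qed.
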